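(* Fix $\alpha\in(0,1]$ and consider $n$ such that $\alpha n$ is a natural number. If $\frac13\le\alpha\le1$ then $M(n,\alpha n)=\left(\frac{2\alpha}{3}+\frac1{18}\right)n^2+O(n)$, and if $0<\alpha\le\frac13$ then $M(n,\alpha n)=\left(\alpha-\frac{\alpha^2}{2}\right)n^2+O(n)$, as $n\to\infty$.
   Context: $M(k,\ell)$ denotes the maximum percolation time, over all sets $A\subseteq[k]\times[\ell]$ that percolate, in $2$-neighbour bootstrap percolation on the grid $[k]\times[\ell]$ (sites adjacent iff at $\ell_1$-distance 1): from $A_0=A$, $A_t=A_{t-1}\cup\{v: v\text{ has at least 2 neighbours in }A_{t-1}\}$; $A$ percolates if eventually all sites are infected, and its percolation time is the least $T$ with $A_T$ the whole grid. *)

(* Defs.v *)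
From HB Require Import structures.
From mathcomp Require Import all_boot all_order all_algebra.
From mathcomp Require Import boolp reals.

Set Implicit Arguments.
Unset Strict Implicit.
Unset Printing Implicit Defensive.

(* The grid [k] x [l], with coordinates numbered from 0. *)
Notation grid k l := ('I_k * 'I_l)%type.

Definition grid_adj (k l : nat) (u v : grid k l) : bool :=
  (`|u.1 - v.1| + `|u.2 - v.2| == 1)%N.

Definition bootstrap_step (k l : nat) (A : {set grid k l}) : {set grid k l} :=
  A :|: [set v | 2 <= #|[set u in A | grid_adj u v]|].

Definition infected (k l : nat) (A : {set grid k l}) (t : nat) :
    {set grid k l} :=
  iter t (@bootstrap_step k l) A.

Definition percolates (k l : nat) (A : {set grid k l}) : Prop :=
  exists t, infected A t == [set: grid k l].

(* The value is the junk 0 when A does not percolate. *)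
Definition percolation_time (k l : nat) (A : {set grid k l}) : nat :=
  if pselect (percolates A) is left h then ex_minn h else 0.

(* For every k and l some A percolates (the full grid does), so this is a
   maximum over a nonempty finite set. *)
Definition max_percolation_time (k l : nat) : nat :=
  \max_(A : {set grid k l} | `[< percolates A >]) percolation_time A.

(* Main.v *)
(**
   Upper bound. A rectangle filled by the seeds it contains is, unless it is a
   single cell, the hull of two smaller such rectangles at distance at most 2.
   Once the slower of the two, with p columns and q rows missing, is full, the
   w x h hull fills up within max(h + p, w + q) + O(1) steps (only the first
   term if q = 0, only the second if p = 0). Write the claimed leading term as
   g(w, h) = w h - h^2 / 2 if 3 h <= w and 2 w h / 3 + w^2 / 18 if
   h <= w <= 3 h, extended symmetrically. Every such merge is paid for by the
   decrease of g up to O(p + q), with one exception: a merge that adds a single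
   row or column. Taking that merge together with the preceding one restores the
   inequality, because the seed of the last column is already present during
   the preceding merge and speeds it up. The errors O(p + q) telescope to O(n).

   Lower bound. Start from a segment of n - d cells in row 0 and attach rows
   whose seeds sit just outside the upper left and the upper right corner in
   turn: each of these d rows also adds a column and is swept from end to end.
   When the full width is reached, each further block of three rows takes two
   sweeps, using two seeds. Taking d close to min(m, n / 3) gives g(n, m) - O(n).
*)
Require Import Defs.
From HB Require Import structures.
From Stdlib Require Import ZArith Lia.
From mathcomp Require Import all_boot all_order all_algebra.
From mathcomp Require Import boolp reals zify lra.
Import Order.TTheory GRing.Theory Num.Theory.

Set Implicit Arguments.
Unset Strict Implicit.
Unset Printing Implicit Defensive.

Local Open Scope Z_scope.

Definition neighbour (x y x' y' : Z) : Prop := Z.abs (x - x') + Z.abs (y - y') = 1.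

Definition bootstrap_closed (U V : Z -> Z -> Prop) : Prop :=
  forall x y x1 y1 x2 y2, neighbour x1 y1 x y -> neighbour x2 y2 x y ->
    (x1 <> x2 \/ y1 <> y2) -> U x1 y1 -> U x2 y2 -> V x y.

Definition process (I : nat -> Z -> Z -> Prop) : Prop :=
  (forall t x y, I t x y -> I t.+1 x y) /\
  (forall t, bootstrap_closed (I t) (I t.+1)).

Fixpoint infZ (A : Z -> Z -> Prop) (t : nat) (x y : Z) : Prop :=
  match t with
  | O => A x y
  | S t' => infZ A t' x y \/
      exists x1 y1 x2 y2, [/\ neighbour x1 y1 x y, neighbour x2 y2 x y,
        (x1 <> x2 \/ y1 <> y2), infZ A t' x1 y1 & infZ A t' x2 y2]
  end.

Lemma infZ_process A : process (infZ A).
Proof.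
split; first by move=> t x y; left.
by move=> t x y x1 y1 x2 y2 *; right; exists x1, y1, x2, y2.
Qed.

Lemma infZ_sub_closed (A U : Z -> Z -> Prop) t x y :
  (forall x y, A x y -> U x y) -> bootstrap_closed U U -> infZ A t x y -> U x y.
Proof.
move=> AU Ucl; elim: t x y => [|t IH] x y //=; first exact: AU.
case=> [/IH //|[x1 [y1 [x2 [y2 [n1 n2 ne i1 i2]]]]]].
exact: (Ucl _ _ _ _ _ _ n1 n2 ne (IH _ _ i1) (IH _ _ i2)).
Qed.

Lemma infZ_mono (A B : Z -> Z -> Prop) t x y :
  (forall x y, A x y -> B x y) -> infZ A t x y -> infZ B t x y.
Proof.
move=> AB; elim: t x y => [|t IH] x y //=; first exact: AB.
case=> [/IH|[x1 [y1 [x2 [y2 [n1 n2 ne i1 i2]]]]]]; first by left.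
by right; exists x1, y1, x2, y2; split=> //; apply: IH.
Qed.

Definition swap_process (I : nat -> Z -> Z -> Prop) t x y := I t y x.

Lemma process_swap I : process I -> process (swap_process I).
Proof.
move=> [I1 I2]; split=> [t x y|t x y x1 y1 x2 y2]; first exact: I1.
rewrite /neighbour /swap_process => n1 n2 ne.
apply: I2; rewrite /neighbour; lia.
Qed.

Lemma process_le I t t' x y : process I -> (t <= t')%N -> I t x y -> I t' x y.
Proof.
move=> [I1 _] le It; rewrite -(subnK le).
by elim: (_ - _)%N => // k IH; rewrite addSn; apply: I1.
Qed.

Lemma corner_fill I t x0 c k x y : process I ->
  (forall u, x0 <= u <= x \/ x <= u <= x0 -> I t u c) ->
  (forall v, c <= v <= y \/ y <= v <= c -> I t x0 v) ->
  Z.abs (x - x0) + Z.abs (y - c) <= Z.of_nat k -> I (t + k)%N x y.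
Proof.
move=> HI; elim: k x y => [|k IH] x y row col le.
  have -> : x = x0 by lia.
  rewrite addn0; apply: col; lia.
have [ex|nx] := Z.eq_dec x x0.
  rewrite ex; apply: (process_le (t := t)) => //; first lia.
  apply: col; lia.
have [ey|ny] := Z.eq_dec y c.
  rewrite ey; apply: (process_le (t := t)) => //; first lia.
  apply: row; lia.
rewrite addnS.
apply: (proj2 HI _ _ _ (x - Z.sgn (x - x0)) y x (y - Z.sgn (y - c))).
- rewrite /neighbour; lia.
- rewrite /neighbour; lia.
- lia.
- by apply: IH => [u hu|v hv|]; [apply: row| apply: col|]; lia.
- by apply: IH => [u hu|v hv|]; [apply: row| apply: col|]; lia.
Qed.

Lemma nearest (a b x : Z) : a <= b -> exists x0, a <= x0 <= b /\
  (x0 = x \/ (x0 = a /\ x < a) \/ (x0 = b /\ b < x)).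
Proof. by move=> ab; exists (Z.max a (Z.min b x)); lia. Qed.

Lemma cross_fill I t a b c d A B lo hi p q k x y : process I ->
  a <= b -> lo <= hi -> c <= lo -> hi <= d -> A <= a -> b <= B ->
  (forall u v, a <= u <= b -> c <= v <= d -> I t u v) ->
  (forall u v, A <= u <= B -> lo <= v <= hi -> I t u v) ->
  A <= x <= B -> c <= y <= d ->
  0 <= p -> a - x <= p -> x - b <= p -> 0 <= q -> lo - y <= q -> y - hi <= q ->
  p + q <= Z.of_nat k -> I (t + k)%N x y.
Proof.
move=> HI ab lohi clo hid Aa bB F row hx hy p0 p1 p2 q0 q1 q2 pq.
have [x0 [x0ab hx0]] := nearest x ab.
have [y0 [y0ab hy0]] := nearest y lohi.
apply: (@corner_fill I t x0 y0) => //.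
- move=> u hu; apply: row; lia.
- move=> v hv; apply: F; lia.
- lia.
Qed.

(* The seed (x', ys) may lie diagonally off the end of the supporting row. *)
Lemma strip_fill I t a b y0 ys x' k x : process I ->
  (forall u, a <= u <= b -> I t u y0) -> Z.abs (ys - y0) = 1 ->
  a - 1 <= x' <= b + 1 -> I t x' ys -> a <= x <= b ->
  Z.abs (x - x') <= Z.of_nat k -> I (t + k)%N x ys.
Proof.
move=> HI row hy hx' seed; elim: k x => [|k IH] x hx le.
  have -> : x = x' by lia.
  by rewrite addn0.
have [ex|nx] := Z.eq_dec x x'.
  by rewrite ex; apply: (process_le (t := t)) => //; lia.
rewrite addnS.
apply: (proj2 HI _ _ _ (x - Z.sgn (x - x')) ys x y0).
- rewrite /neighbour; lia.
- rewrite /neighbour; lia.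
- lia.
- have [e|ne] := Z.eq_dec (x - Z.sgn (x - x')) x'.
    by rewrite e; apply: (process_le (t := t)) => //; lia.
  apply: IH; lia.
- apply: (process_le (t := t)) => //; first lia.
  exact: row.
Qed.

Record rect := Rect { left : Z; right : Z; bot : Z; top : Z }.

Definition in_rect (Q : rect) (x y : Z) : Prop :=
  left Q <= x <= right Q /\ bot Q <= y <= top Q.

Definition nonempty (Q : rect) : Prop := left Q <= right Q /\ bot Q <= top Q.

Definition width (Q : rect) : Z := right Q - left Q + 1.
Definition height (Q : rect) : Z := top Q - bot Q + 1.

Definition subrect (Q Q' : rect) : Prop :=
  [/\ left Q' <= left Q, right Q <= right Q', bot Q' <= bot Q & top Q <= top Q'].

Definition hull (Q Q' : rect) : rect :=
  Rect (Z.min (left Q) (left Q')) (Z.max (right Q) (right Q'))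
       (Z.min (bot Q) (bot Q')) (Z.max (top Q) (top Q')).

Definition close (Q Q' : rect) : Prop :=
  exists x y x' y', [/\ in_rect Q x y, in_rect Q' x' y'
    & Z.abs (x - x') + Z.abs (y - y') <= 2].

Definition filled (I : nat -> Z -> Z -> Prop) (t : nat) (Q : rect) : Prop :=
  forall x y, in_rect Q x y -> I t x y.

Definition swap_rect (Q : rect) := Rect (bot Q) (top Q) (left Q) (right Q).

Lemma filled_le I t t' Q : process I -> (t <= t')%N -> filled I t Q -> filled I t' Q.
Proof. by move=> HI le F x y /F; apply: process_le. Qed.

Lemma filled_subrect I t Q Q' : subrect Q Q' -> filled I t Q' -> filled I t Q.
Proof. move=> [? ? ? ?] F x y [? ?]; apply: F; split; lia. Qed.

Lemma filled_swap I t Q : filled I t Q -> filled (swap_process I) t (swap_rect Q).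
Proof. by move=> F x y [hx hy]; apply: F; split. Qed.

Lemma closeC Q Q' : close Q Q' -> close Q' Q.
Proof. move=> [x [y [x' [y' [? ? ?]]]]]; exists x', y', x, y; split=> //; lia. Qed.

Lemma hullC Q Q' : hull Q Q' = hull Q' Q.
Proof. by congr Rect; lia. Qed.

Definition fill_cost (w h p q : Z) (k : nat) : Prop :=
  (0 < p -> h + p + 2 <= Z.of_nat k) /\ (0 < q -> w + q + 2 <= Z.of_nat k).

(* A row common to both rectangles is infected across the whole hull after one
   step; together with a column of either rectangle it forms an L-shape. *)
Lemma merge_rows I t Q1 Q2 k : process I -> nonempty Q1 -> nonempty Q2 ->
  filled I t Q1 -> filled I t Q2 -> close Q1 Q2 ->
  Z.max (bot Q1) (bot Q2) <= Z.min (top Q1) (top Q2) ->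
  let H := hull Q1 Q2 in
  fill_cost (width H) (height H) (width H - width Q1) (height H - height Q1) k ->
  filled I (t + k)%N H.
Proof.
case: Q1 => a1 b1 c1 d1; case: Q2 => a2 b2 c2 d2.
rewrite /nonempty /close /in_rect /fill_cost /hull /width /height /=.
move=> HI [n1 m1] [n2 m2] F1 F2 [u [v [u' [v' [h1 h2 h3]]]]] ov [kp kq] x y hxy.
rewrite /in_rect /= in hxy.
have J1 X Y : a1 <= X <= b1 /\ c1 <= Y <= d1 -> I t.+1 X Y.
  by move=> h; apply: (proj1 HI); apply: F1.
have J2 X Y : a2 <= X <= b2 /\ c2 <= Y <= d2 -> I t.+1 X Y.
  by move=> h; apply: (proj1 HI); apply: F2.
have row X Y : Z.min a1 a2 <= X <= Z.max b1 b2 ->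
    Z.max c1 c2 <= Y <= Z.min d1 d2 -> I t.+1 X Y.
  move=> hX hY.
  have [h|h] : (a1 <= X <= b1) \/ ~ (a1 <= X <= b1) by lia.
    apply: J1; lia.
  have [h'|h'] : (a2 <= X <= b2) \/ ~ (a2 <= X <= b2) by lia.
    apply: J2; lia.
  have [g|g] : b1 < X \/ X < a1 by lia.
    apply: (proj2 HI _ _ _ (X - 1) Y (X + 1) Y); rewrite /neighbour; try lia.
      apply: F1; rewrite /in_rect /=; lia.
    apply: F2; rewrite /in_rect /=; lia.
  apply: (proj2 HI _ _ _ (X - 1) Y (X + 1) Y); rewrite /neighbour; try lia.
    apply: F2; rewrite /in_rect /=; lia.
  apply: F1; rewrite /in_rect /=; lia.
have [in1|out1] : (a1 <= x <= b1 /\ c1 <= y <= d1) \/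
    ~ (a1 <= x <= b1 /\ c1 <= y <= d1) by lia.
  apply: (process_le (t := t)) => //; first lia.
  exact: F1.
have [yc|ync] : (Z.max c1 c2 <= y <= Z.min d1 d2) \/
    ~ (Z.max c1 c2 <= y <= Z.min d1 d2) by lia.
  apply: (process_le (t := t.+1)); [exact: HI|lia|apply: row; lia].
clear F1 F2 u v u' v' h1 h2 h3.
have [y1|y2] : (c1 <= y <= d1 /\ ~ (a1 <= x <= b1)) \/
    (c2 <= y <= d2 /\ ~ (c1 <= y <= d1)) by lia.
  have {}kp := kp ltac:(lia).
  have -> : (t + k = t.+1 + k.-1)%N by clear -kp n1 m1 ov; lia.
  apply: (cross_fill (p := Z.max b1 b2 - Z.min a1 a2 + 1 - (b1 - a1 + 1))
    (q := Z.max d1 d2 - Z.min c1 c2)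
    _ n1 ov _ _ _ _ (fun u v hu hv => J1 u v (conj hu hv)) row) => //;
    clear J1 J2 row; lia.
have {}kq := kq ltac:(lia).
have -> : (t + k = t.+1 + k.-1)%N by clear -kq n1 m1 n2 ov; lia.
apply: (cross_fill (p := Z.max b1 b2 - Z.min a1 a2)
  (q := Z.max d1 d2 - Z.min c1 c2 + 1 - (d1 - c1 + 1))
  _ n2 ov _ _ _ _ (fun u v hu hv => J2 u v (conj hu hv)) row) => //;
  clear J1 J2 row; lia.
Qed.

Lemma merge_fill I t Q1 Q2 k : process I -> nonempty Q1 -> nonempty Q2 ->
  filled I t Q1 -> filled I t Q2 -> close Q1 Q2 ->
  let H := hull Q1 Q2 in
  fill_cost (width H) (height H) (width H - width Q1) (height H - height Q1) k ->
  filled I (t + k)%N H.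
Proof.
move=> HI N1 N2 F1 F2 cl H cost.
have [ov|nov] : (Z.max (bot Q1) (bot Q2) <= Z.min (top Q1) (top Q2)) \/
   ~ (Z.max (bot Q1) (bot Q2) <= Z.min (top Q1) (top Q2)) by lia.
  exact: merge_rows.
have [ov'|nov'] : (Z.max (left Q1) (left Q2) <= Z.min (right Q1) (right Q2)) \/
   ~ (Z.max (left Q1) (left Q2) <= Z.min (right Q1) (right Q2)) by lia.
  have := @merge_rows (swap_process I) t (swap_rect Q1) (swap_rect Q2) k
    (process_swap HI) _ _ (filled_swap F1) (filled_swap F2).
  move=> /(_ _ _ _ ov') FF x y [hx hy].
  apply: FF => //; try by case: N1; case: N2; split.
    case: cl => x0 [y0 [x' [y' [[? ?] [? ?] ?]]]].
    by exists y0, x0, y', x'; split=> //; lia.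
  by case: cost; split.
move: cl cost nov nov' F1 F2; rewrite /H {H}.
case: Q1 N1 => a1 b1 c1 d1 N1; case: Q2 N2 => a2 b2 c2 d2 N2.
move: N1 N2; rewrite /nonempty /close /in_rect /fill_cost /hull /width /height /=.
move=> [n1 m1] [n2 m2] [u [v [u' [v' [h1 h2 h3]]]]] [kp kq] nov nov' F1 F2 x y hxy.
rewrite /in_rect /= in hxy.
have [in1|out1] : (a1 <= x <= b1 /\ c1 <= y <= d1) \/
    ~ (a1 <= x <= b1 /\ c1 <= y <= d1) by lia.
  apply: (process_le (t := t)) => //; first lia.
  exact: F1.
have [in2|out2] : (a2 <= x <= b2 /\ c2 <= y <= d2) \/
    ~ (a2 <= x <= b2 /\ c2 <= y <= d2) by lia.
  apply: (process_le (t := t)) => //; first lia.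
  exact: F2.
have adx : (a2 = b1 + 1 \/ a1 = b2 + 1) /\ (c2 = d1 + 1 \/ c1 = d2 + 1).
  clear -n1 n2 m1 m2 h1 h2 h3 nov nov'; lia.
have hx12 : (a1 <= x <= b1 /\ c2 <= y <= d2) \/ (a2 <= x <= b2 /\ c1 <= y <= d1).
  clear -n1 n2 m1 m2 adx hxy out1 out2; case: adx => [[?|?] [?|?]]; lia.
have {}kp : Z.max d1 d2 - Z.min c1 c2 + 1 + (b2 - a2 + 1) + 2 <= Z.of_nat k.
  clear -n1 n2 m1 m2 kp adx; lia.
have {}kq : Z.max b1 b2 - Z.min a1 a2 + 1 + (d2 - c2 + 1) + 2 <= Z.of_nat k.
  clear -n1 n2 m1 m2 kq adx; lia.
clear u v u' v' h1 h2 h3 nov nov' hxy out1 out2.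
have -> : (t + k = t.+1 + k.-1)%N by clear -kp n1 n2 m1 m2; lia.
have mid X Y X' Y' : neighbour X' Y X Y -> neighbour X Y' X Y ->
    I t X' Y -> I t X Y' -> I t.+1 X Y.
  move=> ne1 ne2 i1 i2; apply: (proj2 HI _ _ _ X' Y X Y') => //.
  clear -ne1 ne2; rewrite /neighbour in ne1 ne2; lia.
have J1 X Y : a1 <= X <= b1 -> c1 <= Y <= d1 -> I t X Y by move=> ? ?; apply: F1.
have J2 X Y : a2 <= X <= b2 -> c2 <= Y <= d2 -> I t X Y by move=> ? ?; apply: F2.
clear F1 F2.
case: hx12 => [[hx hy]|[hx hy]].
  have [x0 [? ?]] := nearest x n2; have [y0 [? ?]] := nearest y m1.
  have [x1 [? ?]] := nearest x0 n1; have [y1 [? ?]] := nearest y0 m2.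
  have z : I t.+1 x0 y0.
    by apply: (mid _ _ x1 y1); [rewrite /neighbour|rewrite /neighbour|apply: J1|apply: J2];
      clear kp kq; lia.
  apply: (corner_fill (x0 := x0) (c := y0)) => //.
  - move=> X hX; have [->//|nX] := Z.eq_dec X x0.
    by apply: (proj1 HI); apply: J1; clear kp kq; lia.
  - move=> Y hY; have [->//|nY] := Z.eq_dec Y y0.
    by apply: (proj1 HI); apply: J2; clear kp kq; lia.
  - clear kp; case: adx => [[?|?] [?|?]]; lia.
have [x0 [? ?]] := nearest x n1; have [y0 [? ?]] := nearest y m2.
have [x1 [? ?]] := nearest x0 n2; have [y1 [? ?]] := nearest y0 m1.
have z : I t.+1 x0 y0.
  by apply: (mid _ _ x1 y1); [rewrite /neighbour|rewrite /neighbour|apply: J2|apply: J1];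
    clear kp kq; lia.
apply: (corner_fill (x0 := x0) (c := y0)) => //.
- move=> X hX; have [->//|nX] := Z.eq_dec X x0.
  by apply: (proj1 HI); apply: J2; clear kp kq; lia.
- move=> Y hY; have [->//|nY] := Z.eq_dec Y y0.
  by apply: (proj1 HI); apply: J1; clear kp kq; lia.
- clear kq; case: adx => [[?|?] [?|?]]; lia.
Qed.

(** * Internally spanned rectangles *)

Definition restrict (A : Z -> Z -> Prop) (Q : rect) (x y : Z) : Prop :=
  A x y /\ in_rect Q x y.

Definition fills (A : Z -> Z -> Prop) (Q : rect) (t : nat) : Prop :=
  filled (infZ (restrict A Q)) t Q.

Definition spanned (A : Z -> Z -> Prop) (Q : rect) : Prop := exists t, fills A Q t.

Lemma fills_le A Q t t' : (t <= t')%N -> fills A Q t -> fills A Q t'.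
Proof. by apply: filled_le; apply: infZ_process. Qed.

Lemma fills_sub A Q Q' t : subrect Q Q' -> fills A Q t ->
  filled (infZ (restrict A Q')) t Q.
Proof.
move=> [? ? ? ?] F x y /F; apply: infZ_mono => x' y' [? [? ?]].
split=> //; split; lia.
Qed.

Lemma subrect_hull Q Q' : subrect Q (hull Q Q').
Proof. split=> /=; lia. Qed.

Lemma subrect_hullr Q Q' : subrect Q' (hull Q Q').
Proof. split=> /=; lia. Qed.

Lemma fills_hull A Q1 Q2 t k : nonempty Q1 -> nonempty Q2 -> close Q1 Q2 ->
  fills A Q1 t -> fills A Q2 t ->
  let H := hull Q1 Q2 in
  fill_cost (width H) (height H) (width H - width Q1) (height H - height Q1) k ->
  fills A H (t + k)%N.
Proof.
move=> N1 N2 cl F1 F2 H cost; apply: merge_fill => //.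
- exact: infZ_process.
- exact: fills_sub (subrect_hull _ _) F1.
- exact: fills_sub (subrect_hullr _ _) F2.
Qed.

Lemma spanned_hull A Q1 Q2 : nonempty Q1 -> nonempty Q2 -> close Q1 Q2 ->
  spanned A Q1 -> spanned A Q2 -> spanned A (hull Q1 Q2).
Proof.
move=> N1 N2 cl [t1 F1] [t2 F2]; set H := hull Q1 Q2.
exists (maxn t1 t2 + Z.to_nat (2 * width H + 2 * height H + 2))%N.
apply: fills_hull => //.
- by apply: fills_le F1; lia.
- by apply: fills_le F2; lia.
- have [w1 h1] : 1 <= width Q1 /\ 1 <= height Q1.
    by case: N1; rewrite /width /height; lia.
  have [w h] : width Q1 <= width H /\ height Q1 <= height H.
    by rewrite /H /hull /width /height /=; lia.
  rewrite -/H; split; lia.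
Qed.

Lemma rect_ext Q Q' : left Q = left Q' -> right Q = right Q' ->
  bot Q = bot Q' -> top Q = top Q' -> Q = Q'.
Proof. by case: Q; case: Q' => ? ? ? ? ? ? ? ? /= -> -> -> ->. Qed.

Lemma subrect_trans Q1 Q2 Q3 : subrect Q1 Q2 -> subrect Q2 Q3 -> subrect Q1 Q3.
Proof. move=> [? ? ? ?] [? ? ? ?]; split; lia. Qed.

Lemma subrect_lt Q Q' : subrect Q Q' -> Q <> Q' ->
  width Q + height Q < width Q' + height Q'.
Proof.
move=> [? ? ? ?] ne; have [//|ge] := Z.lt_ge_cases (width Q + height Q)
  (width Q' + height Q').
case: ne; apply: rect_ext; rewrite /width /height in ge; lia.
Qed.

Definition proper_spanned (A : Z -> Z -> Prop) (Q P : rect) : Prop :=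
  [/\ nonempty P, subrect P Q, P <> Q & spanned A P].

Definition maximal_spanned (A : Z -> Z -> Prop) (Q P : rect) : Prop :=
  proper_spanned A Q P /\
  forall P', proper_spanned A Q P' -> subrect P P' -> P' = P.

Lemma proper_sub_maximal A Q P : proper_spanned A Q P ->
  exists2 P', maximal_spanned A Q P' & subrect P P'.
Proof.
have [n] := ubnP (Z.to_nat (width Q + height Q - (width P + height P))).
elim: n P => // n IH P ltn prP.
have [[P' [prP' sub ne]]|no] :=
    EM (exists P', [/\ proper_spanned A Q P', subrect P P' & P' <> P]).
  have lt := subrect_lt sub (fun e => ne (esym e)).
  have [_ sQ nQ _] := prP'; have lt' := subrect_lt sQ nQ.
  have [|M maxM subM] := IH P' _ prP'; first lia.
  by exists M => //; apply: subrect_trans subM.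
exists P; last by split; lia.
split=> // P' prP' sub; have [//|ne] := EM (P' = P).
by case: no; exists P'.
Qed.

(* If no two close proper spanned rectangles had hull Q, then the maximal proper
   spanned rectangles would be pairwise far apart, hence their union would be
   closed under the infection rule. *)
Lemma spanned_decompose A Q : nonempty Q -> spanned A Q -> 2 < width Q + height Q ->
  exists Q1 Q2, [/\ proper_spanned A Q Q1, proper_spanned A Q Q2,
    close Q1 Q2 & hull Q1 Q2 = Q].
Proof.
move=> NQ [t F] big; have [//|no] := EM (exists Q1 Q2,
  [/\ proper_spanned A Q Q1, proper_spanned A Q Q2, close Q1 Q2 & hull Q1 Q2 = Q]).
have uniq P1 P2 : maximal_spanned A Q P1 -> maximal_spanned A Q P2 ->
    close P1 P2 -> P1 = P2.
  move=> [pr1 m1] [pr2 m2] cl.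
  have [N1 s1 _ sp1] := pr1; have [N2 s2 _ sp2] := pr2.
  have prH : proper_spanned A Q (hull P1 P2).
    split.
    - by case: N1 N2 => [? ?] [? ?]; split=> /=; lia.
    - by case: s1 s2 => [? ? ? ?] [? ? ? ?]; split=> /=; lia.
    - by move=> e; case: no; exists P1, P2.
    - exact: spanned_hull.
  by rewrite -(m1 _ prH (subrect_hull _ _)) -[RHS](m2 _ prH (subrect_hullr _ _)).
pose U x y := exists2 P, maximal_spanned A Q P & in_rect P x y.
have cover x y : in_rect Q x y -> U x y.
  move=> /F; apply: infZ_sub_closed => {x y}.
    move=> x y [Axy [hx hy]].
    have prP : proper_spanned A Q (Rect x x y y).
      split.
      - by split=> /=; lia.
      - by split=> /=; lia.
      - by move=> e; rewrite -e /width /height /= in big; lia.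
      - exists 0%N => x' y' [/= hx' hy'].
        have [-> ->] : x' = x /\ y' = y by lia.
        by split=> //; split=> /=; lia.
    have [P maxP [/= ? ? ? ?]] := proper_sub_maximal prP.
    by exists P => //; split; lia.
  move=> x y x1 y1 x2 y2 n1 n2 ne [P1 M1 in1] [P2 M2 in2].
  have e : P1 = P2.
    apply: uniq => //; exists x1, y1, x2, y2; split=> //.
    rewrite /neighbour in n1 n2; lia.
  exists P1 => //; rewrite -e in in2.
  case: in1 in2 => [? ?] [? ?]; rewrite /neighbour in n1 n2; split; lia.
have [P maxP inP] : U (left Q) (bot Q) by apply: cover; case: NQ; split; lia.
have [[NP [sl sr sb st] neP _] _] := maxP.
have absorb x y x' y' : in_rect P x y -> in_rect Q x' y' ->
    Z.abs (x - x') + Z.abs (y - y') <= 2 -> in_rect P x' y'.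
  move=> iP iQ d; have [P' maxP' iP'] := cover _ _ iQ.
  by rewrite (uniq P P') //; exists x, y, x', y'.
case: inP => hl hb; case: NQ => ? ?; case: NP => ? ?.
have er : right P = right Q.
  have [//|ne] := Z.eq_dec (right P) (right Q).
  have [] : in_rect P (right P + 1) (bot Q); last by lia.
  by apply: (absorb (right P) (bot Q)); try split; lia.
have et : top P = top Q.
  have [//|ne] := Z.eq_dec (top P) (top Q).
  have [] : in_rect P (left Q) (top P + 1); last by lia.
  by apply: (absorb (left Q) (top P)); try split; lia.
by case: neP; apply: rect_ext; lia.
Qed.

(* Of the two rectangles of a decomposition, take the one that fills last. *)
Lemma last_merge A Q : nonempty Q -> spanned A Q -> 2 < width Q + height Q ->
  exists P, [/\ nonempty P, subrect P Q, P <> Q, spanned A P &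
    forall k t, fill_cost (width Q) (height Q) (width Q - width P)
      (height Q - height P) k -> fills A P t -> fills A Q (t + k)%N].
Proof.
move=> NQ sp big.
have [Q1 [Q2 [[N1 s1 ne1 sp1] [N2 s2 ne2 sp2] cl e]]] := spanned_decompose NQ sp big.
have [slow1|] := EM (forall t, fills A Q1 t -> fills A Q2 t).
  exists Q1; split=> // k t cost F1; rewrite -e.
  by apply: fills_hull => //; rewrite ?e //; apply: slow1.
move=> /existsNP [t0 /not_implyP [F1 nF2]].
exists Q2; split=> // k t cost F2; rewrite -e hullC.
apply: fills_hull => //; rewrite 1?hullC ?e //; first exact: closeC.
apply: fills_le F1; rewrite leqNgt; apply/negP => lt.
by apply: nF2; apply: fills_le F2; apply: ltnW.
Qed.

Lemma spanned_sides A Q : nonempty Q -> spanned A Q ->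
  [/\ exists2 y, bot Q <= y <= top Q & A (left Q) y,
      exists2 y, bot Q <= y <= top Q & A (right Q) y,
      exists2 x, left Q <= x <= right Q & A x (bot Q) &
      exists2 x, left Q <= x <= right Q & A x (top Q)].
Proof.
move=> [nx ny] [t F].
have side (U : Z -> Z -> Prop) x y : in_rect Q x y -> bootstrap_closed U U ->
    ~ U x y -> exists x' y', [/\ in_rect Q x' y', A x' y' & ~ U x' y'].
  move=> iQ Ucl nU; have [//|no] :=
    EM (exists x' y', [/\ in_rect Q x' y', A x' y' & ~ U x' y']).
  case: nU; apply: infZ_sub_closed Ucl (F _ _ iQ) => x' y' [Axy iQ'].
  by have [//|nU] := EM (U x' y'); case: no; exists x', y'.
split.
- have [|x y x1 y1 x2 y2||x [y [[? ?] Axy nU]]] :=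
      side (fun x _ => left Q < x) (left Q) (bot Q).
  + by split; lia.
  + by rewrite /neighbour; lia.
  + by lia.
  + by exists y => //; have <- : x = left Q by lia.
- have [|x y x1 y1 x2 y2||x [y [[? ?] Axy nU]]] :=
      side (fun x _ => x < right Q) (right Q) (bot Q).
  + by split; lia.
  + by rewrite /neighbour; lia.
  + by lia.
  + by exists y => //; have <- : x = right Q by lia.
- have [|x y x1 y1 x2 y2||x [y [[? ?] Axy nU]]] :=
      side (fun _ y => bot Q < y) (left Q) (bot Q).
  + by split; lia.
  + by rewrite /neighbour; lia.
  + by lia.
  + by exists x => //; have <- : y = bot Q by lia.
- have [|x y x1 y1 x2 y2||x [y [[? ?] Axy nU]]] :=
      side (fun _ y => y < top Q) (left Q) (top Q).
  + by split; lia.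
  + by rewrite /neighbour; lia.
  + by lia.
  + by exists x => //; have <- : y = top Q by lia.
Qed.

(** * Fill times of consecutive merges *)

Definition seeded_sides (I : nat -> Z -> Z -> Prop) (t : nat) (Q : rect) : Prop :=
  [/\ exists2 y, bot Q <= y <= top Q & I t (left Q) y,
      exists2 y, bot Q <= y <= top Q & I t (right Q) y,
      exists2 x, left Q <= x <= right Q & I t x (bot Q) &
      exists2 x, left Q <= x <= right Q & I t x (top Q)].

Lemma spanned_seeded_sides A Q Q' t : nonempty Q -> subrect Q Q' -> spanned A Q ->
  seeded_sides (infZ (restrict A Q')) t Q.
Proof.
move=> NQ [sl sr sb st] sp.
have seed x y : in_rect Q x y -> A x y -> infZ (restrict A Q') t x y.
  move=> [? ?] Axy; apply: (process_le (t := 0%N)); [exact: infZ_process|lia|].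
  by split=> //; split; lia.
have [[y1 ? ?] [y2 ? ?] [x1 ? ?] [x2 ? ?]] := spanned_sides NQ sp.
case: NQ => ? ?.
split; [exists y1|exists y2|exists x1|exists x2] => //; apply: seed => //; split; lia.
Qed.

Lemma fill_seed I t P x y k : process I -> nonempty P -> filled I t P -> I t x y ->
  close P (Rect x x y y) ->
  let H := hull P (Rect x x y y) in
  fill_cost (width H) (height H) (width H - width P) (height H - height P) k ->
  filled I (t + k)%N H.
Proof.
move=> HI NP F seed cl; apply: merge_fill => //; first by split=> /=; lia.
by move=> x' y' [/= ? ?]; have [-> ->] : x' = x /\ y' = y by lia.
Qed.

Lemma fill_two_columns I t P Q k : process I -> nonempty P -> subrect P Q ->
  height P = height Q -> width Q - width P <= 2 -> seeded_sides I t Q ->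
  filled I t P -> height Q + 4 <= Z.of_nat k -> filled I (t + k)%N Q.
Proof.
case: P => a b c d; case: Q => a' b' c' d'.
rewrite /nonempty /width /height /seeded_sides.
move=> HI NP [/= sl sr sb st] hh ww [[y1 hy1 s1] [y2 hy2 s2] _ _] F hk.
rewrite /= in NP hh ww hy1 s1 hy2 s2 hk.
move=> x y [/= hx hy].
have [xb|xb] : x <= b \/ b < x by lia.
  have FF : filled I (t + k) (hull (Rect a b c d) (Rect a' a' y1 y1)).
    apply: fill_seed => //.
    - by exists a, y1, a', y1; rewrite /in_rect /=; split; lia.
    - by rewrite /fill_cost /width /height /=; lia.
  by apply: FF; split=> /=; lia.
have FF : filled I (t + k) (hull (Rect a b c d) (Rect b' b' y2 y2)).
  apply: fill_seed => //.
  - by exists b, y2, b', y2; rewrite /in_rect /=; split; lia.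
  - by rewrite /fill_cost /width /height /=; lia.
by apply: FF; split=> /=; lia.
Qed.

Lemma fill_row_and_column I t P Q k : process I -> nonempty P -> subrect P Q ->
  height Q - height P = 1 -> width Q - width P = 1 -> seeded_sides I t Q ->
  filled I t P -> height Q + 4 <= Z.of_nat k -> width Q + 4 <= Z.of_nat k ->
  filled I (t + k)%N Q.
Proof.
case: P => a b c d; case: Q => a' b' c' d'.
rewrite /nonempty /width /height /seeded_sides.
move=> HI NP [/= sl sr sb st] hh ww sides F hk wk.
rewrite /= in NP hh ww hk wk.
have -> : (t + k = (t + k.-1).+1)%N by clear -hk NP hh; lia.
have [xs hxs [ys hys sy]] : exists2 xs, (xs = a' /\ a' < a \/ xs = b' /\ b < b') &
    exists2 ys, c' <= ys <= d' & I t xs ys.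
  case: sides => /= -[y1 hy1 s1] [y2 hy2 s2] _ _.
  have [lt|ge] : a' < a \/ b < b' by lia.
    by exists a'; [lia|exists y1].
  by exists b'; [lia|exists y2].
have [yr hyr [xr hxr sx]] : exists2 yr, (yr = c' /\ c' < c \/ yr = d' /\ d < d') &
    exists2 xr, a' <= xr <= b' & I t xr yr.
  case: sides => /= _ _ [x1 hx1 s1] [x2 hx2 s2].
  have [lt|ge] : c' < c \/ d < d' by lia.
    by exists c'; [lia|exists x1].
  by exists d'; [lia|exists x2].
have col : filled I (t + k.-1) (hull (Rect a b c d) (Rect xs xs ys ys)).
  apply: fill_seed => //.
  - have [x0 [? ?]] := nearest xs (proj1 NP); have [y0 [? ?]] := nearest ys (proj2 NP).
    exists x0, y0, xs, ys; rewrite /in_rect /=; split; try lia.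
  - rewrite /fill_cost /width /height /=; lia.
have row : filled I (t + k.-1) (hull (Rect a b c d) (Rect xr xr yr yr)).
  apply: fill_seed => //.
  - have [x0 [? ?]] := nearest xr (proj1 NP); have [y0 [? ?]] := nearest yr (proj2 NP).
    exists x0, y0, xr, yr; rewrite /in_rect /=; split; try lia.
  - rewrite /fill_cost /width /height /=; lia.
move=> x y [/= hx hy].
have [iny|ny] : c <= y <= d \/ y = yr by lia.
  by apply: (proj1 HI); apply: col; split=> /=; lia.
have [inx|nx] : a <= x <= b \/ x = xs by lia.
  by apply: (proj1 HI); apply: row; split=> /=; lia.
have [inP|outP] : (xs = x /\ ys = y \/ xr = x /\ yr = y) \/
    ~ (xs = x /\ ys = y \/ xr = x /\ yr = y) by lia.
  apply: (process_le (t := t)) => //; first lia.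
  by case: inP => -[<- <-].
have [x0 [? ?]] := nearest x (proj1 NP); have [y0 [? ?]] := nearest y (proj2 NP).
apply: (proj2 HI _ _ _ x0 y x y0).
- rewrite /neighbour; lia.
- rewrite /neighbour; lia.
- lia.
- by apply: row; split=> /=; lia.
- by apply: col; split=> /=; lia.
Qed.

(* The seed on the extra row of Q' fills that row along P first; then P extended
   by this row has full height and lacks only two columns. *)
Lemma fill_row_two_columns I t P Q' Q k : process I -> nonempty P ->
  subrect P Q' -> subrect Q' Q -> height Q' = height Q ->
  height Q - height P = 1 -> width Q' - width P = 1 -> width Q - width Q' = 1 ->
  seeded_sides I t Q' -> seeded_sides I t Q -> filled I t P ->
  width Q + height Q + 4 <= Z.of_nat k -> filled I (t + k)%N Q.
Proof.
case: P => a b c d; case: Q' => a1 b1 c1 d1; case: Q => a2 b2 c2 d2.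
rewrite /nonempty /width /height.
move=> HI NP [/= ? ? ? ?] [/= ? ? ? ?] h1 h2 w1 w2 sides' sides F hk.
rewrite /= in NP h1 h2 w1 w2 hk.
set k1 := Z.to_nat (b2 - a2 + 1).
have -> : (t + k = t + k1 + (k - k1))%N by rewrite /k1; lia.
have FP : filled I (t + k1)%N (Rect a b c2 d2).
  move=> x y [/= hx hy].
  have [iny|ny] : c <= y <= d \/ ~ (c <= y <= d) by lia.
    by apply: (process_le (t := t)) => //; [lia|apply: F].
  have [xr hxr sx] : exists2 xr, a1 <= xr <= b1 & I t xr y.
    case: sides' => /= _ _ [x1 hx1 s1] [x2 hx2 s2].
    have [e|e] : y = c1 \/ y = d1 by lia.
      by exists x1 => //; rewrite e.
    by exists x2 => //; rewrite e.
  have [y0 [? ?]] := nearest y (proj2 NP).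
  apply: (strip_fill (a := a) (b := b) (y0 := y0) (x' := xr)) => //; try lia.
  by move=> u hu; apply: F; split=> /=; lia.
apply: fill_two_columns FP _ => //; rewrite /nonempty /subrect /width /height /=; try lia.
- by split; lia.
- case: sides => /= -[y1 ? ?] [y2 ? ?] [x1 ? ?] [x2 ? ?].
  by split=> /=; [exists y1|exists y2|exists x1|exists x2] => //;
    apply: process_le HI _ _; try eassumption; lia.
Qed.

Definition wide_bound (w h : Z) : Z :=
  if 3 * h <=? w then 18 * w * h - 9 * h * h else 12 * w * h + w * w.

Definition time_bound (w h : Z) : Z :=
  if h <=? w then wide_bound w h else wide_bound h w.

Ltac time_bound_cases := rewrite /time_bound /wide_bound;
  repeat match goal with |- context [?a <=? ?b] => destruct (Z.leb_spec a b) end.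

Lemma time_boundC w h : time_bound w h = time_bound h w.
Proof.
by time_bound_cases; try lia; (have -> : w = h by lia); lia.
Qed.

Lemma time_bound_mono w w' h h' : 0 <= w' <= w -> 0 <= h' <= h ->
  time_bound w' h' <= time_bound w h.
Proof.
have mono1 u u' v : 0 <= u' <= u -> 0 <= v -> time_bound u' v <= time_bound u v.
  by move=> *; time_bound_cases; nia.
move=> hw hh; apply: (Z.le_trans _ (time_bound w h')).
  by apply: mono1; lia.
by rewrite (time_boundC w h') (time_boundC w h); apply: mono1; lia.
Qed.

Lemma time_bound11 w h : 1 <= w -> 1 <= h ->
  time_bound (w - 1) (h - 1) + 18 * w <= time_bound w h + 200.
Proof. by move=> *; time_bound_cases; nia. Qed.

Lemma time_bound20 w h : 2 <= w -> 1 <= h ->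
  time_bound (w - 2) h + 18 * h <= time_bound w h + 200.
Proof. by move=> *; time_bound_cases; nia. Qed.

Lemma time_bound30 w h : 3 <= w -> 1 <= h ->
  time_bound (w - 3) h + 36 * h <= time_bound w h + 400.
Proof. by move=> *; time_bound_cases; nia. Qed.

Lemma time_bound21 w h : 2 <= w -> 1 <= h ->
  time_bound (w - 2) (h - 1) + 18 * (w + h) <= time_bound w h + 400.
Proof. by move=> *; time_bound_cases; nia. Qed.

Lemma time_bound31 w h : 3 <= w -> 1 <= h ->
  time_bound (w - 3) (h - 1) + 36 * h <= time_bound w h + 400.
Proof. by move=> *; time_bound_cases; nia. Qed.

Lemma time_bound11' w h : 1 <= w -> 1 <= h ->
  time_bound (w - 1) (h - 1) + 18 * h <= time_bound w h + 200.
Proof.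
by move=> *; rewrite (time_boundC (w - 1)) (time_boundC w); apply: time_bound11.
Qed.

Lemma time_bound12 w h : 1 <= w -> 2 <= h ->
  time_bound (w - 1) (h - 2) + 18 * (w + h) <= time_bound w h + 400.
Proof.
move=> *; rewrite (time_boundC (w - 1)) (time_boundC w) (Z.add_comm w).
exact: time_bound21.
Qed.

Lemma time_bound22 w h : 2 <= w -> 2 <= h ->
  time_bound (w - 2) (h - 2) + 36 * h <= time_bound w h + 500.
Proof.
move=> hw hh.
have := @time_bound11' w h ltac:(lia) ltac:(lia).
have := @time_bound11' (w - 1) (h - 1) ltac:(lia) ltac:(lia).
have -> : w - 1 - 1 = w - 2 by lia.
have -> : h - 1 - 1 = h - 2 by lia.
lia.
Qed.

Lemma infZ_swap A t x y : infZ A t x y -> infZ (fun x y => A y x) t y x.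
Proof.
elim: t x y => [|t IH] x y //=.
case=> [/IH|[x1 [y1 [x2 [y2 [n1 n2 ne i1 i2]]]]]]; first by left.
right; exists y1, x1, y2, x2; split; try exact: IH.
all: by rewrite /neighbour in n1 n2 *; lia.
Qed.

Lemma fills_swap A Q t : fills A Q t -> fills (fun x y => A y x) (swap_rect Q) t.
Proof.
move=> F x y [/= ? ?]; have /F /infZ_swap : in_rect Q y x by [].
by apply: infZ_mono => x' y' [? [? ?]].
Qed.

Definition bounded_fill (A : Z -> Z -> Prop) (Q : rect) : Prop :=
  exists2 t, fills A Q t &
    18 * Z.of_nat t <= time_bound (width Q) (height Q) + 1000 * (width Q + height Q).

Lemma bounded_fill_swap A Q :
  bounded_fill (fun x y => A y x) (swap_rect Q) -> bounded_fill A Q.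
Proof.
move=> [t /fills_swap F b]; exists t; first by case: Q F b.
by rewrite time_boundC (Z.add_comm (width Q)).
Qed.

Lemma bounded_fill_step A P Q k : bounded_fill A P ->
  (forall t, fills A P t -> fills A Q (t + k)%N) ->
  18 * Z.of_nat k + time_bound (width P) (height P) <=
    time_bound (width Q) (height Q)
    + 1000 * (width Q - width P + (height Q - height P)) ->
  bounded_fill A Q.
Proof. by move=> [t F b] step le; exists (t + k)%N; [apply: step|lia]. Qed.

Lemma subrect_dims P Q : subrect P Q -> width P <= width Q /\ height P <= height Q.
Proof. by move=> [? ? ? ?]; rewrite /width /height; lia. Qed.

Lemma nonempty_dims P : nonempty P -> 1 <= width P /\ 1 <= height P.
Proof. by move=> [? ?]; rewrite /width /height; lia. Qed.

(* When the last merge adds a single column its cost is too large to be charged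
   to that column alone, so the previous merge is taken into account as well. *)
Lemma bounded_fill_column A P Q : nonempty P -> subrect P Q -> spanned A P ->
  spanned A Q -> width Q - width P = 1 -> height P = height Q ->
  (forall P', nonempty P' -> spanned A P' ->
    width P' + height P' < width Q + height Q -> bounded_fill A P') ->
  (forall k t, fill_cost (width Q) (height Q) 1 0 k ->
    fills A P t -> fills A Q (t + k)%N) ->
  bounded_fill A Q.
Proof.
move=> NP sPQ spP spQ dw dh IH stepQ.
have NQ : nonempty Q by case: NP sPQ => ? ? [? ? ? ?]; split; lia.
have [w1 h1] := nonempty_dims NP.
have sidesQ t : seeded_sides (infZ (restrict A Q)) t Q.
  by apply: spanned_seeded_sides => //; split; lia.
have sidesP t : seeded_sides (infZ (restrict A Q)) t P.
  exact: spanned_seeded_sides.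
set w := width Q in dw IH stepQ *; set h := height Q in dh IH stepQ *.
have ew : width P = w - 1 by lia.
have k0 : fill_cost w h 1 0 (Z.to_nat (h + 3)) by split; lia.
have [small|big] := Z.le_gt_cases (width P + height P) 2.
  apply: (bounded_fill_step (P := P) (k := Z.to_nat (h + 3))).
  - by apply: IH => //; lia.
  - by move=> t; apply: stepQ.
  - have := @time_bound_mono w (width P) h (height P).
    by rewrite -/w -/h; lia.
have [P' [N' s' ne' sp' step']] := last_merge NP spP ltac:(lia).
have lt' := subrect_lt s' ne'; have [dw' dh'] := subrect_dims s'.
have [w1' h1'] := nonempty_dims N'.
have sPQ' := subrect_trans s' sPQ.
have B' : bounded_fill A P' by apply: IH => //; lia.
have two_steps k : (forall t, fills A P' t -> fills A P (t + k)%N) ->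
    forall t, fills A P' t -> fills A Q (t + (k + Z.to_nat (h + 3)))%N.
  by move=> st t F; rewrite addnA; apply: stepQ => //; apply: st.
rewrite dh in step'.
set p := width P - width P' in step' *; set q := h - height P' in step' *.
have ep : width P' = w - 1 - p by rewrite /p; lia.
have eq : height P' = h - q by rewrite /q; lia.
have p0 : 0 <= p by lia.
have q0 : 0 <= q by lia.
have mono u v : u <= 1 + p -> v <= q ->
    0 <= u <= w -> 0 <= v <= h ->
    time_bound (w - 1 - p) (h - q) <= time_bound (w - u) (h - v).
  by move=> *; apply: time_bound_mono; lia.
have [[p1 q1]|npq10] := EM (p = 1 /\ q = 0).
  apply: (bounded_fill_step (k := Z.to_nat (h + 4))) B' _ _.
    move=> t F; apply: (fill_two_columns _ N' sPQ') => //.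
    - exact: infZ_process.
    - by rewrite -/h; lia.
    - by rewrite -/w; lia.
    - exact: fills_sub F.
    - by rewrite -/h; lia.
  have := @time_bound20 w h; have := mono 2 0.
  by rewrite -/w -/h ep eq Z.sub_0_r; lia.
have [[p1 q1]|npq01] := EM (p = 0 /\ q = 1).
  apply: (bounded_fill_step (k := Z.to_nat (Z.max w h + 4))) B' _ _.
    move=> t F; apply: (fill_row_and_column _ N' sPQ') => //.
    - exact: infZ_process.
    - by rewrite -/w; lia.
    - exact: fills_sub F.
    - by rewrite -/h; lia.
    - by rewrite -/w; lia.
  have := @time_bound11 w h; have := @time_bound11' w h; have := mono 1 1.
  by rewrite -/w -/h ep eq; lia.
have [[p1 q1]|npq11] := EM (p = 1 /\ q = 1).
  apply: (bounded_fill_step (k := Z.to_nat (w + h + 4))) B' _ _.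
    move=> t F; apply: (fill_row_two_columns _ N' s' sPQ) => //.
    - exact: infZ_process.
    - exact: fills_sub F.
    - by rewrite -/h -/w; lia.
  have := @time_bound21 w h; have := mono 2 1.
  by rewrite -/w -/h ep eq; lia.
have [q1|q1] := Z.eq_dec q 0.
  apply: (bounded_fill_step (k := Z.to_nat (h + p + 2) + Z.to_nat (h + 3))) B' _ _.
    by apply: two_steps => t; apply: step'; split; lia.
  have := @time_bound30 w h; have := mono 3 0.
  by rewrite -/w -/h ep eq Z.sub_0_r; lia.
have [p1|p1] := Z.eq_dec p 0.
  apply: (bounded_fill_step (k := Z.to_nat (w + q + 2) + Z.to_nat (h + 3))) B' _ _.
    by apply: two_steps => t; apply: step'; split; lia.
  have := @time_bound12 w h; have := mono 1 2.
  by rewrite -/w -/h ep eq; lia.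
apply: (bounded_fill_step
  (k := Z.to_nat (Z.max (h + p) (w + q) + 2) + Z.to_nat (h + 3))) B' _ _.
  by apply: two_steps => t; apply: step'; split; lia.
rewrite -/w -/h ep eq.
have [wh|wh] := Z.le_gt_cases h w.
  by have := @time_bound21 w h; have := mono 2 1; lia.
have [p2|p2] := Z.le_gt_cases 2 p.
  by have := @time_bound31 w h; have := mono 3 1; lia.
by have := @time_bound22 w h; have := mono 2 2; lia.
Qed.

Lemma spanned_bounded_fill A Q : nonempty Q -> spanned A Q -> bounded_fill A Q.
Proof.
have [n] := ubnP (Z.to_nat (width Q + height Q)).
elim: n A Q => // n IHn A Q ltn NQ spQ.
have [w1 h1] := nonempty_dims NQ.
have IH P : nonempty P -> spanned A P ->
    width P + height P < width Q + height Q -> bounded_fill A P.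
  by move=> NP spP lt; apply: IHn => //; have [? ?] := nonempty_dims NP; lia.
have [small|big] := Z.le_gt_cases (width Q + height Q) 2.
  exists 0%N; last by rewrite /time_bound /wide_bound;
    (have [-> ->] : width Q = 1 /\ height Q = 1 by lia).
  have [[y hy Axy] _ _ _] := spanned_sides NQ spQ.
  move=> x' y' [hx' hy']; rewrite /width /height in w1 h1 small.
  have [-> ->] : x' = left Q /\ y' = y by lia.
  by split=> //; split; lia.
have [P [NP sP neP spP step]] := last_merge NQ spQ ltac:(lia).
have lt := subrect_lt sP neP; have [dw dh] := subrect_dims sP.
have [w1' h1'] := nonempty_dims NP.
have BP : bounded_fill A P by apply: IH => //; lia.
set w := width Q in IH step lt dw w1 *; set h := height Q in IH step lt dh h1 *.
have [[p1 q1]|npq10] := EM (w - width P = 1 /\ h - height P = 0).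
  apply: (bounded_fill_column NP sP) => //; first by rewrite -/h; lia.
  by rewrite p1 q1 in step.
have [[p1 q1]|npq01] := EM (w - width P = 0 /\ h - height P = 1).
  apply: bounded_fill_swap.
  have spS R : spanned (fun x y => A y x) R -> spanned A (swap_rect R).
    by move=> [t /fills_swap F]; exists t.
  have spS' R : spanned A R -> spanned (fun x y => A y x) (swap_rect R).
    by move=> [t /fills_swap F]; exists t.
  apply: (bounded_fill_column (P := swap_rect P)).
  - by case: NP; split.
  - by case: sP; split.
  - exact: spS'.
  - exact: spS'.
  - exact: q1.
  - by move: p1; rewrite /w /width /height /=; lia.
  - move=> R NR spR ltR; apply: bounded_fill_swap; apply: IH; last 2 first.
    + exact: spS.
    + by move: ltR; rewrite /w /h /width /height /=; lia.
    + by case: NR; split.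
  - move=> k t [c1 c2] F.
    apply: (@fills_swap A Q); apply: step; last first.
      by case: P F {NP sP neP spP lt dw dh w1' h1' BP npq10 p1 q1} => ? ? ? ? /fills_swap.
    by split=> [|_]; [lia|]; rewrite q1; apply: c1.
have [q0|q0] := Z.eq_dec (h - height P) 0.
  apply: (bounded_fill_step (k := Z.to_nat (h + (w - width P) + 2))) BP _ _.
    by move=> t; apply: step; split; lia.
  have := @time_bound20 w h; have := @time_bound_mono (w - 2) (width P) h (height P).
  by rewrite -/w -/h; lia.
have [p0|p0] := Z.eq_dec (w - width P) 0.
  apply: (bounded_fill_step (k := Z.to_nat (w + (h - height P) + 2))) BP _ _.
    by move=> t; apply: step; split; lia.
  have := @time_bound20 h w; have := @time_bound_mono w (width P) (h - 2) (height P).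
  by rewrite (time_boundC h w) (time_boundC (h - 2) w) -/w -/h; lia.
apply: (bounded_fill_step
  (k := Z.to_nat (Z.max (h + (w - width P)) (w + (h - height P)) + 2))) BP _ _.
  by move=> t; apply: step; split; lia.
have := @time_bound11 w h; have := @time_bound11' w h.
have := @time_bound_mono (w - 1) (width P) (h - 1) (height P).
by rewrite -/w -/h; lia.
Qed.

(** * From the grid to the plane *)

Definition grid_rect (n m : nat) : rect :=
  Rect 0 (Z.of_nat n - 1) 0 (Z.of_nat m - 1).

Definition cells (n m : nat) (A : {set grid n m}) (x y : Z) : Prop :=
  exists2 v, v \in A & x = Z.of_nat v.1 /\ y = Z.of_nat v.2.

Lemma in_grid_rect n m (v : grid n m) :
  in_rect (grid_rect n m) (Z.of_nat v.1) (Z.of_nat v.2).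
Proof. by case: v => [[x ?] [y ?]]; split=> /=; lia. Qed.

Lemma grid_rectP n m x y : in_rect (grid_rect n m) x y ->
  exists v : grid n m, x = Z.of_nat v.1 /\ y = Z.of_nat v.2.
Proof.
move=> [/= hx hy].
have hx' : (Z.to_nat x < n)%N by lia.
have hy' : (Z.to_nat y < m)%N by lia.
by exists (Ordinal hx', Ordinal hy') => /=; lia.
Qed.

Lemma grid_cell_inj n m (u v : grid n m) :
  Z.of_nat u.1 = Z.of_nat v.1 -> Z.of_nat u.2 = Z.of_nat v.2 -> u = v.
Proof.
case: u v => [u1 u2] [v1 v2] /= e1 e2.
by congr (_, _); apply: val_inj => /=; lia.
Qed.

Lemma in_rect_closed Q : bootstrap_closed (in_rect Q) (in_rect Q).
Proof.
move=> x y x1 y1 x2 y2; rewrite /neighbour => n1 n2 ne [? ?] [? ?]; split; lia.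
Qed.

Lemma cells_in_grid n m (A : {set grid n m}) x y :
  cells A x y -> in_rect (grid_rect n m) x y.
Proof. by move=> [v _ [-> ->]]; apply: in_grid_rect. Qed.

Lemma infZ_cells_in_grid n m (A : {set grid n m}) t x y :
  infZ (cells A) t x y -> in_rect (grid_rect n m) x y.
Proof.
by apply: infZ_sub_closed => [?? /cells_in_grid //|]; apply: in_rect_closed.
Qed.

Lemma grid_adjP n m (u v : grid n m) : reflect
  (neighbour (Z.of_nat u.1) (Z.of_nat u.2) (Z.of_nat v.1) (Z.of_nat v.2))
  (grid_adj u v).
Proof.
case: u v => [u1 u2] [v1 v2]; rewrite /neighbour /grid_adj /=.
by apply: (iffP eqP); lia.
Qed.

Lemma infected_cells n m (A : {set grid n m}) t (v : grid n m) :
  v \in infected A t <-> infZ (cells A) t (Z.of_nat v.1) (Z.of_nat v.2).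
Proof.
elim: t v => [|t IH] v.
  split=> [vA|[u uA [e1 e2]]]; first by exists v.
  by rewrite (grid_cell_inj e1 e2).
rewrite /infected iterS -/(infected A t) /bootstrap_step inE /= in_set.
split.
- case/orP=> [/IH|/card_gt1P [u1 [u2 [+ + ne]]]]; first by left.
  rewrite !inE => /andP [/IH i1 /grid_adjP a1] /andP [/IH i2 /grid_adjP a2].
  right; exists (Z.of_nat u1.1), (Z.of_nat u1.2), (Z.of_nat u2.1), (Z.of_nat u2.2).
  split=> //; have [e1|] := Z.eq_dec (Z.of_nat u1.1) (Z.of_nat u2.1); last by left.
  by right=> e2; rewrite (grid_cell_inj e1 e2) eqxx in ne.
- case=> [/IH -> //|[x1 [y1 [x2 [y2 [n1 n2 ne i1 i2]]]]]].
  have [u1 [ex1 ey1]] := grid_rectP (infZ_cells_in_grid i1).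
  have [u2 [ex2 ey2]] := grid_rectP (infZ_cells_in_grid i2).
  apply/orP; right; apply/card_gt1P; exists u1, u2; subst.
  split; rewrite ?inE.
  + by apply/andP; split; [apply/IH|apply/grid_adjP].
  + by apply/andP; split; [apply/IH|apply/grid_adjP].
  + by apply/eqP => e; rewrite e in ne; case: ne.
Qed.

Lemma infected_setT n m (A : {set grid n m}) t :
  (infected A t == [set: grid n m]) <-> filled (infZ (cells A)) t (grid_rect n m).
Proof.
split=> [/eqP e x y /grid_rectP [v [-> ->]]|F].
  by apply/infected_cells; rewrite e inE.
apply/eqP/setP => v; rewrite inE; apply/infected_cells; apply: F.
exact: in_grid_rect.
Qed.

Lemma percolation_time_le n m (A : {set grid n m}) t :
  infected A t == [set: grid n m] -> (percolation_time A <= t)%N.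
Proof.
rewrite /percolation_time; case: pselect => // h ht.
by case: ex_minnP => k _; apply.
Qed.

Lemma percolation_time_ge n m (A : {set grid n m}) (v : grid n m) T :
  percolates A -> (forall t, v \in infected A t -> (T <= t)%N) ->
  (T <= percolation_time A)%N.
Proof.
move=> perc le; rewrite /percolation_time; case: pselect => // h.
by case: ex_minnP => k /eqP e _; apply: le; rewrite e inE.
Qed.

Lemma max_percolation_time_upper n m : (0 < n)%N -> (0 < m)%N ->
  18 * Z.of_nat (max_percolation_time n m) <=
    time_bound (Z.of_nat n) (Z.of_nat m) + 1000 * (Z.of_nat n + Z.of_nat m).
Proof.
move=> n0 m0.
have hw : width (grid_rect n m) = Z.of_nat n by rewrite /width /=; lia.
have hh : height (grid_rect n m) = Z.of_nat m by rewrite /height /=; lia.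
set B := (time_bound _ _ + _); suff le A : percolates A ->
    18 * Z.of_nat (percolation_time (A : {set grid n m})) <= B.
  have : (max_percolation_time n m <= Z.to_nat (B / 18))%N.
    apply/bigmax_leqP => A /asboolP /le h.
    by have := Z.div_le_lower_bound B 18 _ ltac:(lia) h; lia.
  have B0 : 0 <= B.
    have := @time_bound_mono (Z.of_nat n) 0 (Z.of_nat m) 0.
    by have -> : time_bound 0 0 = 0 by []; rewrite /B; lia.
  by have := Z.mul_div_le B 18 ltac:(lia); have := Z.div_pos B 18; lia.
move=> [t0 /infected_setT F0].
have restr x y : restrict (cells A) (grid_rect n m) x y <-> cells A x y.
  by split=> [[]//|c]; split=> //; apply: cells_in_grid c.
have sp : spanned (cells A) (grid_rect n m).
  by exists t0 => x y /F0; apply: infZ_mono => ? ? /restr.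
have [|t F] := @spanned_bounded_fill _ (grid_rect n m) _ sp.
  by split=> /=; lia.
rewrite hw hh -/B => le.
have : (percolation_time A <= t)%N; last by lia.
by apply/percolation_time_le/infected_setT => x y /F; apply: infZ_mono => ? ? /restr.
Qed.

(** * A slowly percolating set *)

Lemma eventually_fill_seed I P R x y : process I -> nonempty P ->
  (exists t, filled I t P) -> (exists t, I t x y) -> close P (Rect x x y y) ->
  subrect R (hull P (Rect x x y y)) -> exists t, filled I t R.
Proof.
move=> HI NP [t F] [t' s] cl sub; set H := hull _ _ in sub.
exists (maxn t t' + Z.to_nat (2 * width H + 2 * height H + 2))%N.
apply: (filled_subrect sub); apply: fill_seed => //.
- by apply: filled_le F => //; lia.
- by apply: process_le s => //; lia.
- have [? ?] := nonempty_dims NP.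
  have [? ?] := subrect_dims (subrect_hull P (Rect x x y y)).
  by rewrite -/H; split; lia.
Qed.

Definition grow_stage (n e x : Z) : Z :=
  if x <? e then 2 * (e - x)
  else if n - 1 - e <? x then 2 * (x - (n - 1 - e)) - 1 else 0.

(* Rows 0, ..., 2e: the initial segment of row 0 is widened alternately to the
   right (odd rows) and to the left (even rows), one column per row. Above them
   come j blocks of three full-width rows with two seeds each. *)
Definition slow_seed (n e j x y : Z) : Prop :=
  [/\ 0 <= x <= n - 1, 0 <= y <= 2 * e + 3 * j &
    if y <=? 2 * e then y = grow_stage n e x
    else ((y - 2 * e - 1) mod 3 = 1 /\ x = n - 1) \/
         ((y - 2 * e - 1) mod 3 = 2 /\ x = 0)].

Definition row_start (n e y : Z) : Z :=
  1 + (y - 1) * (n - 1 - 2 * e) + (y * (y - 1)) / 2.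

(* A lower bound for the time at which (x, y) gets infected: each row fills
   from its seed to the opposite end before the next one starts. *)
Definition delay (n e x y : Z) : Z :=
  let block := row_start n e (2 * e + 1) + ((y - 2 * e - 1) / 3) * (2 * n - 2) in
  if y <=? 2 * e then
    if y <? grow_stage n e x then row_start n e (grow_stage n e x)
    else if y =? grow_stage n e x then 0
    else if y mod 2 =? 0 then row_start n e y + (x - (e - y / 2) - 1)
    else row_start n e y + (n - 1 - e + (y + 1) / 2 - 1 - x)
  else if (y - 2 * e - 1) mod 3 =? 0 then block + (n - 1 - x)
  else if (y - 2 * e - 1) mod 3 =? 1 then
    if x =? n - 1 then 0 else block + (n - 1 - x)
  else if x =? 0 then 0 else block + (n - 2 + x).

Lemma row_startS n e y : row_start n e (y + 1) = row_start n e y + (n - 1 - 2 * e) + y.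
Proof.
rewrite /row_start.
have -> : (y + 1) * (y + 1 - 1) = y * (y - 1) + y * 2 by lia.
rewrite Z.div_add; lia.
Qed.

Lemma row_start_next n e a b : a = b + 1 ->
  row_start n e a = row_start n e b + (n - 1 - 2 * e) + b.
Proof. by move=> ->; apply: row_startS. Qed.

Lemma row_start_le n e a b : 2 * e + 1 <= n -> 1 <= a <= b ->
  row_start n e a <= row_start n e b.
Proof.
move=> hn [a1 ab]; have -> : b = a + Z.of_nat (Z.to_nat (b - a)) by lia.
elim: (Z.to_nat _) => [|k IH]; first by rewrite Z.add_0_r; lia.
have := @row_start_next n e (a + Z.of_nat k.+1) (a + Z.of_nat k) ltac:(lia).
lia.
Qed.

Lemma row_start1 n e : row_start n e 1 = 1.
Proof. by rewrite /row_start. Qed.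

Lemma grow_stageP n e x : [\/ x < e /\ grow_stage n e x = 2 * (e - x),
    [/\ e <= x, n - 1 - e < x & grow_stage n e x = 2 * (x - (n - 1 - e)) - 1] |
    [/\ e <= x, x <= n - 1 - e & grow_stage n e x = 0]].
Proof.
rewrite /grow_stage; have [h1|h1] := Z.ltb_spec x e; first by constructor 1.
by have [h2|h2] := Z.ltb_spec (n - 1 - e) x; [constructor 2|constructor 3].
Qed.

Variant delay_spec (n e x y : Z) : Z -> Prop :=
  | DelaySide of y <= 2 * e & y < grow_stage n e x :
      delay_spec n e x y (row_start n e (grow_stage n e x))
  | DelaySeed of y <= 2 * e & y = grow_stage n e x : delay_spec n e x y 0
  | DelayEven i of y <= 2 * e & grow_stage n e x < y & y = 2 * i :
      delay_spec n e x y (row_start n e y + (x - (e - i) - 1))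
  | DelayOdd i of y <= 2 * e & grow_stage n e x < y & y = 2 * i + 1 :
      delay_spec n e x y (row_start n e y + (n - 1 - e + i - x))
  | DelayBlock0 i of 0 <= i & y = 2 * e + 1 + 3 * i : delay_spec n e x y
      (row_start n e (2 * e + 1) + i * (2 * n - 2) + (n - 1 - x))
  | DelaySeed1 i of 0 <= i & y = 2 * e + 2 + 3 * i & x = n - 1 :
      delay_spec n e x y 0
  | DelayBlock1 i of 0 <= i & y = 2 * e + 2 + 3 * i & x <> n - 1 :
      delay_spec n e x y
        (row_start n e (2 * e + 1) + i * (2 * n - 2) + (n - 1 - x))
  | DelaySeed2 i of 0 <= i & y = 2 * e + 3 + 3 * i & x = 0 : delay_spec n e x y 0
  | DelayBlock2 i of 0 <= i & y = 2 * e + 3 + 3 * i & x <> 0 :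
      delay_spec n e x y
        (row_start n e (2 * e + 1) + i * (2 * n - 2) + (n - 2 + x)).

Lemma delayP n e x y : delay_spec n e x y (delay n e x y).
Proof.
rewrite /delay; have [h|h] := Z.leb_spec y (2 * e).
  have [h1|h1] := Z.ltb_spec y (grow_stage n e x); first exact: DelaySide.
  have [h2|h2] := Z.eqb_spec y (grow_stage n e x); first exact: DelaySeed.
  have dm := Z.div_mod y 2 ltac:(lia); have mb := Z.mod_pos_bound y 2 ltac:(lia).
  have [h3|h3] := Z.eqb_spec (y mod 2) 0.
    by apply: DelayEven; lia.
  have e1 : y mod 2 = 1 by lia.
  have -> : n - 1 - e + (y + 1) / 2 - 1 - x = n - 1 - e + y / 2 - x.
    have -> : y + 1 = 2 * (y / 2) + 1 * 2 by lia.
    by rewrite Z.div_add // Z.mul_comm Z.div_mul //; lia.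
  by apply: DelayOdd; lia.
have dm := Z.div_mod (y - 2 * e - 1) 3 ltac:(lia).
have mb := Z.mod_pos_bound (y - 2 * e - 1) 3 ltac:(lia).
have dp := Z.div_pos (y - 2 * e - 1) 3 ltac:(lia) ltac:(lia).
have [h1|h1] := Z.eqb_spec ((y - 2 * e - 1) mod 3) 0.
  by apply: DelayBlock0 => //; lia.
have [h2|h2] := Z.eqb_spec ((y - 2 * e - 1) mod 3) 1.
  have [h3|h3] := Z.eqb_spec x (n - 1).
    by apply: DelaySeed1 dp _ h3; lia.
  by apply: DelayBlock1 => //; lia.
have [h3|h3] := Z.eqb_spec x 0.
  by apply: DelaySeed2 dp _ h3; lia.
by apply: DelayBlock2 => //; lia.
Qed.

Lemma neighbour_cases x' y' x y : neighbour x' y' x y ->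
  [\/ x' = x + 1 /\ y' = y, x' = x - 1 /\ y' = y, x' = x /\ y' = y + 1
    | x' = x /\ y' = y - 1].
Proof.
rewrite /neighbour => h.
have : (x' = x + 1 /\ y' = y) \/ (x' = x - 1 /\ y' = y) \/
  (x' = x /\ y' = y + 1) \/ (x' = x /\ y' = y - 1) by lia.
by case=> [?|[?|[?|?]]]; [constructor 1|constructor 2|constructor 3|constructor 4].
Qed.

(* A cell other than a seed needs two infected neighbours, and at least one of
   them is not the exceptional one: this propagates [delay] as a lower bound. *)
Definition late_but_one (n e x y : Z) : Prop :=
  exists x0 y0, forall x' y', neighbour x' y' x y -> 0 <= x' <= n - 1 -> 0 <= y' ->
    (x' <> x0 \/ y' <> y0) -> delay n e x y <= delay n e x' y' + 1.

Ltac compare_starts n e hn s b :=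
  first
  [ (have: s = b by lia) => ->
  | have := @row_start_next n e s b ltac:(lia)
  | have := @row_start_next n e b s ltac:(lia)
  | have := @row_start_le n e s b hn ltac:(lia)
  | have := @row_start_le n e b s hn ltac:(lia) ].

Ltac neighbour_delay n e hn s :=
  let x' := fresh "x'" in let y' := fresh "y'" in let nb := fresh "nb" in
  intros x' y' nb; intros; apply neighbour_cases in nb;
  destruct nb as [[? ?]|[? ?]|[? ?]|[? ?]]; subst x' y'; try (exfalso; lia);
  match goal with |- _ <= delay _ _ ?u ?v + 1 =>
    destruct (grow_stageP n e u) as [[? ?]|[? ? ?]|[? ? ?]]; try (exfalso; lia);
    destruct (delayP n e u v); try (exfalso; lia)
  end;
  match goal with
  | |- _ <= row_start _ _ ?b + 1 => compare_starts n e hn s b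
  | |- _ <= row_start _ _ ?b + _ + 1 => compare_starts n e hn s b
  | |- _ <= row_start _ _ ?b + ?i * _ + _ + 1 =>
      compare_starts n e hn s b; (have: i = 0 by lia) => ->
  | |- _ <= 0 + 1 => have := row_start1 n e; compare_starts n e hn s 1
  end; lia.

Lemma late_side n e x y : 0 <= e -> 2 * e + 1 <= n -> 0 <= x <= n - 1 -> 0 <= y ->
  y <= 2 * e -> y < grow_stage n e x -> late_but_one n e x y.
Proof.
move=> he hn hx hy h1 h2; rewrite /late_but_one.
have -> : delay n e x y = row_start n e (grow_stage n e x).
  by case: (delayP n e x y) => *; try done; lia.
have [h3|h3] := Z.eq_dec (y + 1) (grow_stage n e x).
  exists x, (y + 1).
  by case: (grow_stageP n e x) => [[? ?]|[? ? ?]|[? ? ?]];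
    neighbour_delay n e hn (grow_stage n e x).
case: (grow_stageP n e x) => [[? ?]|[? ? ?]|[? ? ?]].
- exists (x + 1), y; neighbour_delay n e hn (grow_stage n e x).
- exists (x - 1), y; neighbour_delay n e hn (grow_stage n e x).
- lia.
Qed.

Lemma late_even n e x y i : 0 <= e -> 2 * e + 1 <= n -> 0 <= x <= n - 1 -> 0 <= y ->
  y <= 2 * e -> grow_stage n e x < y -> y = 2 * i -> late_but_one n e x y.
Proof.
move=> he hn hx hy h1 h2 h3; rewrite /late_but_one.
have -> : delay n e x y = row_start n e y + (x - (e - i) - 1).
  by case: (delayP n e x y) => *; try lia.
have [h4|h4] := Z.eq_dec (x - 1) (e - i).
  exists (x - 1), y.
  by case: (grow_stageP n e x) => [[? ?]|[? ? ?]|[? ? ?]];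
    neighbour_delay n e hn y.
exists x, (y - 1).
by case: (grow_stageP n e x) => [[? ?]|[? ? ?]|[? ? ?]];
  neighbour_delay n e hn y.
Qed.

Lemma late_odd n e x y i : 0 <= e -> 2 * e + 1 <= n -> 0 <= x <= n - 1 -> 0 <= y ->
  y <= 2 * e -> grow_stage n e x < y -> y = 2 * i + 1 -> late_but_one n e x y.
Proof.
move=> he hn hx hy h1 h2 h3; rewrite /late_but_one.
have -> : delay n e x y = row_start n e y + (n - 1 - e + i - x).
  by case: (delayP n e x y) => *; try lia.
have [h4|h4] := Z.eq_dec (x + 1) (n - e + i).
  exists (x + 1), y.
  by case: (grow_stageP n e x) => [[? ?]|[? ? ?]|[? ? ?]];
    neighbour_delay n e hn y.
exists x, (y - 1).
by case: (grow_stageP n e x) => [[? ?]|[? ? ?]|[? ? ?]];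
  neighbour_delay n e hn y.
Qed.

Ltac neighbour_block n e i :=
  let x' := fresh "x'" in let y' := fresh "y'" in let nb := fresh "nb" in
  intros x' y' nb; intros; apply neighbour_cases in nb;
  destruct nb as [[? ?]|[? ?]|[? ?]|[? ?]]; subst x' y'; try (exfalso; lia);
  match goal with |- _ <= delay _ _ ?u ?v + 1 =>
    destruct (delayP n e u v); try (exfalso; lia)
  end;
  try match goal with
  | |- _ <= row_start _ _ _ + ?i' * _ + _ + 1 =>
      first [ (have: i' = i by lia) => -> | (have: i' = i - 1 by lia) => ->
            | (have: i' = i + 1 by lia) => -> ]; lia
  end.

Lemma late_block n e x y : 0 <= e -> 2 * e + 1 <= n -> 3 <= n -> 0 <= x <= n - 1 ->
  2 * e < y -> delay n e x y <> 0 -> late_but_one n e x y.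
Proof.
move=> he hn hn3 hx hy; rewrite /late_but_one.
case: (delayP n e x y) => [||i|i|i i0 ey|//|i i0 ey nx|//|i i0 ey nx] //; try lia; move=> _.
- have [ex|nx] := Z.eq_dec x (n - 1); last first.
    by exists x, (y - 1); neighbour_block n e i.
  by exists x, (y + 1); neighbour_block n e i; (have -> : i = 0 by lia);
    have := row_start1 n e;
    (case: (grow_stageP n e x) => [[? ?]|[? ? ?]|[? ? ?]]; try (exfalso; lia));
    try (match goal with |- _ -> _ <= row_start _ _ ?b + _ + 1 =>
      compare_starts n e hn (2 * e + 1) b end; lia);
    (have -> : 2 * e + 1 = 1 by lia); lia.
- have [ex|nx'] := Z.eq_dec x (n - 2).
    by exists (n - 1), y; neighbour_block n e i.
  have [ex|nx''] := Z.eq_dec x 0.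
    by exists x, (y + 1); neighbour_block n e i.
  by exists x, (y + 1); neighbour_block n e i.
- have [ex|nx'] := Z.eq_dec x 1.
    by exists 0, y; neighbour_block n e i.
  by exists x, (y - 1); neighbour_block n e i.
Qed.

Lemma delay_seed n e j x y : slow_seed n e j x y -> delay n e x y = 0.
Proof.
move=> [hx hy]; case: Z.leb_spec => h sd.
  by case: (delayP n e x y) => *; lia.
have dm := Z.div_mod (y - 2 * e - 1) 3 ltac:(lia).
by case: (delayP n e x y) => *; lia.
Qed.

Lemma row_start_pos n e y : 2 * e + 1 <= n -> 1 <= y -> 1 <= row_start n e y.
Proof. by move=> hn hy; have := @row_start_le n e 1 y hn; rewrite row_start1; lia. Qed.

Lemma delay_late n e j x y : 0 <= e -> 2 * e + 1 <= n -> 3 <= n -> 0 <= x <= n - 1 ->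
  0 <= y <= 2 * e + 3 * j -> ~ slow_seed n e j x y -> late_but_one n e x y.
Proof.
move=> he hn hn3 hx hy ns.
have nseed : y <= 2 * e -> y <> grow_stage n e x.
  by move=> h1 h2; apply: ns; split=> //; case: Z.leb_spec => //; lia.
case ed: _ / (delayP n e x y) => [h1 h2|h1 h2|i h1 h2 h3|i h1 h2 h3
  |i i0 ey|i i0 ey ex|i i0 ey ex|i i0 ey ex|i i0 ey ex].
- by apply: late_side; lia.
- by lia.
- by apply: (late_even (i := i)); lia.
- by apply: (late_odd (i := i)); lia.
- apply: late_block => //; try lia.
  rewrite ed; have := @row_start_pos n e (2 * e + 1).
  by have := Z.mul_nonneg_nonneg i (2 * n - 2); lia.
- case: ns; split=> //; case: Z.leb_spec => h; first lia.
  left; split=> //; rewrite ey (_ : _ - 1 = 1 + i * 3); last lia.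
  by rewrite Z.mod_add.
- apply: late_block => //; try lia.
  rewrite ed; have := @row_start_pos n e (2 * e + 1).
  by have := Z.mul_nonneg_nonneg i (2 * n - 2); lia.
- case: ns; split=> //; case: Z.leb_spec => h; first lia.
  right; split=> //; rewrite ey (_ : _ - 1 = 2 + i * 3); last lia.
  by rewrite Z.mod_add.
- apply: late_block => //; try lia.
  rewrite ed; have := @row_start_pos n e (2 * e + 1).
  by have := Z.mul_nonneg_nonneg i (2 * n - 2); lia.
Qed.

Lemma infZ_delay n e j t x y : 0 <= e -> 2 * e + 1 <= n -> 3 <= n -> 0 <= j ->
  infZ (slow_seed n e j) t x y -> delay n e x y <= Z.of_nat t.
Proof.
move=> he hn hn3 hj.
pose Q := Rect 0 (n - 1) 0 (2 * e + 3 * j).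
have inQ u v s : infZ (slow_seed n e j) s u v -> in_rect Q u v.
  apply: infZ_sub_closed; first by move=> ? ? [].
  move=> x0 y0 x1 y1 x2 y2; rewrite /neighbour => n1 n2 ne [? ?] [? ?]; split; lia.
elim: t x y => [|t IH] x y; first by move=> /delay_seed ->.
move=> it; have [hx hy] := inQ _ _ _ it; rewrite /= in hx hy.
have [/delay_seed ->|ns] := EM (slow_seed n e j x y); first lia.
case: it => [/IH|[x1 [y1 [x2 [y2 [n1 n2 ne i1 i2]]]]]]; first lia.
have [x0 [y0 late]] := delay_late he hn hn3 hx hy ns.
have [/= hx1 hy1] := inQ _ _ _ i1; have [/= hx2 hy2] := inQ _ _ _ i2.
have [l1 l2] := (IH _ _ i1, IH _ _ i2).
have [ne1|ne2] : (x1 <> x0 \/ y1 <> y0) \/ (x2 <> x0 \/ y2 <> y0) by lia.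
  by have := late _ _ n1 hx1 ltac:(lia) ne1; lia.
by have := late _ _ n2 hx2 ltac:(lia) ne2; lia.
Qed.

Lemma slow_seed_spans n e j : 0 <= e -> 2 * e + 1 <= n -> 0 <= j ->
  exists t, filled (infZ (slow_seed n e j)) t (Rect 0 (n - 1) 0 (2 * e + 3 * j)).
Proof.
move=> he hn hj; set I := infZ _.
have HI : process I by exact: infZ_process.
have seed x y : slow_seed n e j x y -> exists t, I t x y by exists 0%N.
have widen k : Z.of_nat k <= e ->
    exists t, filled I t (Rect (e - Z.of_nat k) (n - 1 - e + Z.of_nat k) 0 (2 * Z.of_nat k)).
  elim: k => [|k IH] hk.
    exists 0%N => x y [hx hy]; cbn [left right bot top] in hx, hy; split; [lia|lia|].
    by case: Z.leb_spec; case: (grow_stageP n e x) => [[? ?]|[? ? ?]|[? ? ?]]; lia.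
  have : 0 <= Z.of_nat k /\ Z.of_nat k + 1 <= e by lia.
  have -> : Z.of_nat k.+1 = Z.of_nat k + 1 by lia.
  move: (IH ltac:(lia)); move: (Z.of_nat k) => i F [i0 hi].
  have F1 : exists t, filled I t (Rect (e - i) (n - e + i) 0 (2 * i + 1)).
    apply: (eventually_fill_seed (x := n - e + i) (y := 2 * i + 1) HI _ F).
    + by split; cbn [left right bot top hull]; lia.
    + apply: seed; split; [lia|lia|].
      by case: Z.leb_spec; case: (grow_stageP n e (n - e + i)) => [[? ?]|[? ? ?]|[? ? ?]]; lia.
    + by exists (n - 1 - e + i), (2 * i), (n - e + i), (2 * i + 1);
        rewrite /in_rect; split; cbn [left right bot top]; lia.
    + by split; cbn [left right bot top hull]; lia.
  have F2 : exists t, filled I t (Rect (e - (i + 1)) (n - 1 - e + (i + 1)) 0 (2 * (i + 1))).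
    apply: (eventually_fill_seed (x := e - i - 1) (y := 2 * i + 2) HI _ F1).
    + by split; cbn [left right bot top hull]; lia.
    + apply: seed; split; [lia|lia|].
      by case: Z.leb_spec; case: (grow_stageP n e (e - i - 1)) => [[? ?]|[? ? ?]|[? ? ?]]; lia.
    + by exists (e - i), (2 * i + 1), (e - i - 1), (2 * i + 2);
        rewrite /in_rect; split; cbn [left right bot top]; lia.
    + by split; cbn [left right bot top hull]; lia.
  exact: F2.
have rise k : Z.of_nat k <= j ->
    exists t, filled I t (Rect 0 (n - 1) 0 (2 * e + 3 * Z.of_nat k)).
  elim: k => [|k IH] hk.
    have [t F] := widen (Z.to_nat e) ltac:(lia).
    by exists t; apply: filled_subrect F; split; cbn [left right bot top]; lia.
  have : 0 <= Z.of_nat k /\ Z.of_nat k + 1 <= j by lia.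
  have -> : Z.of_nat k.+1 = Z.of_nat k + 1 by lia.
  move: (IH ltac:(lia)); move: (Z.of_nat k) => i F [i0 hi].
  have F1 : exists t, filled I t (Rect 0 (n - 1) 0 (2 * e + 2 + 3 * i)).
    apply: (eventually_fill_seed (x := n - 1) (y := 2 * e + 2 + 3 * i) HI _ F).
    + by split; cbn [left right bot top hull]; lia.
    + apply: seed; split; [lia|lia|].
      case: Z.leb_spec => [|_]; first lia.
      by left; split=> //; rewrite (_ : _ - 1 = 1 + i * 3); [rewrite Z.mod_add|lia].
    + by exists (n - 1), (2 * e + 3 * i), (n - 1), (2 * e + 2 + 3 * i);
        rewrite /in_rect; split; cbn [left right bot top]; lia.
    + by split; cbn [left right bot top hull]; lia.
  have F2 : exists t, filled I t (Rect 0 (n - 1) 0 (2 * e + 3 * (i + 1))).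
    apply: (eventually_fill_seed (x := 0) (y := 2 * e + 3 + 3 * i) HI _ F1).
    + by split; cbn [left right bot top hull]; lia.
    + apply: seed; split; [lia|lia|].
      case: Z.leb_spec => [|_]; first lia.
      by right; split=> //; rewrite (_ : _ - 1 = 2 + i * 3); [rewrite Z.mod_add|lia].
    + by exists 0, (2 * e + 2 + 3 * i), 0, (2 * e + 3 + 3 * i);
        rewrite /in_rect; split; cbn [left right bot top]; lia.
    + by split; cbn [left right bot top hull]; lia.
  exact: F2.
by have [t F] := rise (Z.to_nat j) ltac:(lia); exists t;
  apply: filled_subrect F; split; cbn [left right bot top]; lia.
Qed.

Lemma delay_last n e j : 0 <= e -> 2 * e + 1 <= n -> 3 <= n -> 0 <= j ->
  2 * e * (n - 1 - 2 * e) + e * (2 * e + 1) + 2 * j * (n - 1) <=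
  delay n e (n - 1) (2 * e + 3 * j).
Proof.
move=> he hn hn3 hj.
have er : row_start n e (2 * e + 1) = 1 + 2 * e * (n - 1 - 2 * e) + e * (2 * e + 1).
  rewrite /row_start (_ : (2 * e + 1) * (2 * e + 1 - 1) = e * (2 * e + 1) * 2); last lia.
  by rewrite Z.div_mul //; lia.
case: (delayP n e (n - 1) (2 * e + 3 * j)) => [h1 h2|h1 h2|i h1 h2 h3|i h1 h2 h3
  |i i0 ey|i i0 ey ex|i i0 ey ex|i i0 ey ex|i i0 ey ex]; try (exfalso; lia).
- by case: (grow_stageP n e (n - 1)) => [[? ?]|[? ? ?]|[? ? ?]]; lia.
- by case: (grow_stageP n e (n - 1)) => [[? ?]|[? ? ?]|[? ? ?]]; lia.
- have ej : j = 0 by lia.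
  by have := @row_start_next n e (2 * e + 1) (2 * e + 3 * j); rewrite ej; lia.
- by (have -> : j = i + 1 by lia); lia.
Qed.

Lemma max_percolation_time_lower (n e j : nat) : (3 <= n)%N -> (2 * e + 1 <= n)%N ->
  let n' := Z.of_nat n in let e' := Z.of_nat e in let j' := Z.of_nat j in
  2 * e' * (n' - 1 - 2 * e') + e' * (2 * e' + 1) + 2 * j' * (n' - 1) <=
  Z.of_nat (max_percolation_time n (2 * e + 3 * j + 1)).
Proof.
move=> n3 en n' e' j'; set m := (2 * e + 3 * j + 1)%N.
pose A : {set grid n m} :=
  [set v : grid n m | `[< slow_seed n' e' j' (Z.of_nat v.1) (Z.of_nat v.2) >]].
have em : Z.of_nat m - 1 = 2 * e' + 3 * j' by rewrite /m /e' /j'; lia.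
have cellsA x y : cells A x y <-> slow_seed n' e' j' x y.
  split=> [[v vA [-> ->]]|s]; first by move: vA; rewrite inE => /asboolP.
  have [|v [ex ey]] := @grid_rectP n m x y.
    by case: s => hx hy _; split; cbn [left right bot top grid_rect]; rewrite ?em.
  by exists v => //; rewrite inE; apply/asboolP; rewrite -ex -ey.
have perc : percolates A.
  have [t F] := @slow_seed_spans n' e' j' ltac:(lia) ltac:(lia) ltac:(lia).
  exists t; apply/infected_setT => x y; rewrite /grid_rect em => /F.
  by apply: infZ_mono => ? ? /cellsA.
have [|v [ex ey]] := @grid_rectP n m (n' - 1) (2 * e' + 3 * j').
  by split; cbn [left right bot top grid_rect]; rewrite ?em /n'; lia.
have last := @delay_last n' e' j' ltac:(lia) ltac:(lia) ltac:(lia) ltac:(lia).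
have : (Z.to_nat (delay n' e' (n' - 1) (2 * e' + 3 * j')) <= percolation_time A)%N.
  apply: (percolation_time_ge (v := v)) => // t /infected_cells; rewrite -ex -ey => it.
  have := @infZ_delay n' e' j' t (n' - 1) (2 * e' + 3 * j').
  have : infZ (slow_seed n' e' j') t (n' - 1) (2 * e' + 3 * j').
    by apply: infZ_mono it => ? ? /cellsA.
  by move=> it' /(_ ltac:(lia) ltac:(lia) ltac:(lia) ltac:(lia) it'); lia.
have : (percolation_time A <= max_percolation_time n m)%N.
  by apply: (leq_bigmax_cond (F := @percolation_time n m)); apply/asboolP.
lia.
Qed.

Lemma time_bound_le_area w h : 0 <= h <= w -> time_bound w h <= 18 * w * h.
Proof. by move=> *; time_bound_cases; nia. Qed.

Lemma max_percolation_time_asymp : exists K : nat, forall n m : nat,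
  (0 < m)%N -> (m <= n)%N ->
  Z.abs (18 * Z.of_nat (max_percolation_time n m)
         - time_bound (Z.of_nat n) (Z.of_nat m)) <= Z.of_nat K * Z.of_nat n.
Proof.
exists (Z.to_nat 2000) => n m m0 mn; rewrite Z2Nat.id //.
have := @max_percolation_time_upper n m ltac:(lia) m0.
suff : time_bound (Z.of_nat n) (Z.of_nat m) <=
    18 * Z.of_nat (max_percolation_time n m) + 2000 * Z.of_nat n by lia.
have area := @time_bound_le_area (Z.of_nat n) (Z.of_nat m) ltac:(lia).
have [small|[m4 n12]] : (m < 4 \/ n < 12)%N \/ (4 <= m)%N /\ (12 <= n)%N by lia.
  have : Z.of_nat n * Z.of_nat m <= 12 * Z.of_nat n by nia.
  by lia.
have [thin|thick] := Z.le_gt_cases (3 * Z.of_nat m) (Z.of_nat n).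
  have [j [e [hj em]]] : exists j e : nat, (j <= 1)%N /\ m = (2 * e + 3 * j + 1)%N.
    have [o|o] := boolP (odd m).
      by exists 0%N, (m./2); lia.
    by exists 1%N, (m./2 - 2)%N; lia.
  have := @max_percolation_time_lower n e j ltac:(lia) ltac:(lia); rewrite -em; cbv zeta.
  have em' : Z.of_nat m = 2 * Z.of_nat e + 3 * Z.of_nat j + 1 by lia.
  rewrite /time_bound /wide_bound; case: Z.leb_spec => ?; last by lia.
  case: Z.leb_spec => ?; last by lia.
  rewrite em'; have [-> |->] : Z.of_nat j = 0 \/ Z.of_nat j = 1 by lia.
  - by move: n12; clear; lia.
  - by move: n12; clear; lia.
have [j [e [k [em ek hk]]]] : exists j e : nat, exists k : Z,
    [/\ m = (2 * e + 3 * j + 1)%N, Z.of_nat n = 6 * Z.of_nat e + k & -20 <= k <= 20].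
  pose q := (n %/ 3)%N; pose j := ((m - q) %/ 3)%N.
  have hq : (3 * q <= n < 3 * q + 3)%N by rewrite /q; lia.
  have hj : (3 * j + q <= m < 3 * j + q + 3)%N by rewrite /j; lia.
  have [o|o] := boolP (odd (m - 3 * j)%N).
    exists j, ((m - 3 * j)./2), (Z.of_nat n - 6 * Z.of_nat ((m - 3 * j)./2)).
    by split; lia.
  exists j.+1, ((m - 3 * j)./2 - 2)%N, (Z.of_nat n - 6 * Z.of_nat ((m - 3 * j)./2 - 2)).
  by split; lia.
have := @max_percolation_time_lower n e j ltac:(lia) ltac:(lia); rewrite -em; cbv zeta.
have em' : Z.of_nat m = 2 * Z.of_nat e + 3 * Z.of_nat j + 1 by lia.
rewrite /time_bound /wide_bound; case: Z.leb_spec => ?; last by lia.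
case: Z.leb_spec => ?; first by lia.
have k2 : k * k <= 400 by nia.
have ksq : (Z.of_nat n - 6 * Z.of_nat e) * (Z.of_nat n - 6 * Z.of_nat e) <= 400.
  by rewrite ek (_ : 6 * Z.of_nat e + k - 6 * Z.of_nat e = k) //; lia.
have en : 6 * Z.of_nat e <= Z.of_nat n + 20 by lia.
have jn : 3 * Z.of_nat j <= Z.of_nat n by lia.
rewrite em'; move: ksq en jn n12; clear; move: (Z.of_nat (max_percolation_time n m)).
by move=> M; lia.
Qed.

Local Close Scope Z_scope.
Local Open Scope ring_scope.
Unset Implicit Arguments.

Theorem theorem17 (R : realType) (alpha : R) (halpha : 0 < alpha <= 1) :
  (1 / 3 <= alpha ->
     exists (C : R) (N : nat), forall n m : nat, (N <= n)%N ->
       m%:R = alpha * n%:R ->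
       `| (max_percolation_time n m)%:R
          - (2 * alpha / 3 + 1 / 18) * n%:R ^+ 2 | <= C * n%:R) /\
  (alpha <= 1 / 3 ->
     exists (C : R) (N : nat), forall n m : nat, (N <= n)%N ->
       m%:R = alpha * n%:R ->
       `| (max_percolation_time n m)%:R
          - (alpha - alpha ^+ 2 / 2) * n%:R ^+ 2 | <= C * n%:R).
Proof.
case/andP: halpha => a0 a1.
have sizes (n m : nat) : (1 <= n)%N -> m%:R = alpha * n%:R -> (0 < m)%N /\ (m <= n)%N.
  move=> n1 e; have n0 : 0 < n%:R :> R by rewrite ltr0n.
  split; first by rewrite -(ltr0n R) e mulr_gt0.
  by rewrite -(ler_nat R) e ger_pMl.
have [K bound] := max_percolation_time_asymp.
split=> ha; exists K%:R, 1%N => n m n1 e; have [m0 mn] := sizes n m n1 e;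
  have := bound n m m0 mn; set M := max_percolation_time n m => bnd.
- have nm : (n <= 3 * m)%N.
    by rewrite -(ler_nat R) natrM e; have := ler0n R n; nra.
  have [lo hi] : (12 * n * m + n * n <= 18 * M + K * n)%N /\
      (18 * M <= 12 * n * m + n * n + K * n)%N.
    move: bnd; rewrite /time_bound /wide_bound.
    by case: Z.leb_spec => h1; case: Z.leb_spec => h2; nia.
  move: lo hi; rewrite -!(ler_nat R) !natrD !natrM e ler_norml => lo hi.
  by apply/andP; split; lra.
- have nm : (3 * m <= n)%N.
    by rewrite -(ler_nat R) natrM e; have := ler0n R n; nra.
  have [lo hi] : (18 * n * m <= 18 * M + 9 * m * m + K * n)%N /\
      (18 * M + 9 * m * m <= 18 * n * m + K * n)%N.
    move: bnd; rewrite /time_bound /wide_bound.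
    by case: Z.leb_spec => h1; case: Z.leb_spec => h2; nia.
  move: lo hi; rewrite -!(ler_nat R) !natrD !natrM e ler_norml => lo hi.
  by apply/andP; split; lra.
Qed.
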